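(* Let $d\ge1$, $m>0$, $r\ge1$, $n\in\mathbb{N}$ and $\gamma\in\big[0,\frac{d+1}{2}\big)$. If $g(r)=r^{-\gamma}$, then $$G_n(r)\ge\left(\frac C2\right)^{n-1}\frac{\Gamma(d-\gamma)^n}{\Gamma((d-\gamma)n)}\,r^{(\frac{d+1}{2}-\gamma)(n-1)},$$ where $C=C(r_0)$ with $r_0=R(a_0,b)$ for $a_0=b=d-\gamma$. If $g(r)=(1\vee r)^{-\gamma}$, then $$G_n(r)\ge\left(\frac C2\right)^{n-1}\frac{\Gamma(d)^n}{\Gamma(dn)}\,r^{(\frac{d+1}{2}-\gamma)(n-1)},$$ where $C=C(r_0)$ with $r_0=R(a_0,b)$ for $a_0=1$ and $b=d$.
   Context: $\mathbb{N}=\{1,2,\dots\}$, $a\vee b=\max(a,b)$, $a\wedge b=\min(a,b)$; $\lfloor b\rfloor$, $\lceil b\rceil$ are floor and ceiling and $\{b\}=b-\lfloor b\rfloor$. Here $g$ is the profile of the density $f(x)=e^{-m|x|}g(|x|)$ on $\mathbb{R}^d$. Functions $G_n$: $G_1\equiv1$ on $[0,\infty)$ and, for $n\in\mathbb{N}$, $G_{n+1}(0)=0$ and, for $r>0$, $$G_{n+1}(r):=\frac{1}{g(r)}\int_0^rg(r-\rho)g(\rho)G_n(\rho)\,d\rho\quad\text{if }d=1,$$ $$G_{n+1}(r):=\frac{1}{g(r)\,r^{\frac{d-1}{2}}}\int_0^r\left(\int_0^{\sqrt{\rho\wedge(r-\rho)}}e^{-ms^2}s^{d-2}\,ds\right)g(r-\rho)(r-\rho)^{\frac{d-1}{2}}g(\rho)\rho^{\frac{d-1}{2}}G_n(\rho)\,d\rho\quad\text{if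 }d\ge2.$$ Constants: $C(r_0):=1$ if $d=1$, $C(r_0):=\frac{e^{-mr_0}}{d-1}$ if $d>1$, and $$R(a_0,b):=\left(\frac{8\lceil b\rceil^{\lfloor b\rfloor}}{a_0^{1-\{b\}}}\right)^{\frac1{a_0}}\big(2^{\frac1{a_0}}e^{\frac1e}\big)^{2\lfloor b\rfloor}.$$ *)

(* Defs.v *)
From HB Require Import structures.
From mathcomp Require Export all_boot all_order all_algebra.
From mathcomp Require Export all_classical all_reals all_analysis.
Export Order.TTheory GRing.Theory Num.Theory.
Export numFieldNormedType.Exports.

Set Implicit Arguments.
Unset Strict Implicit.
Unset Printing Implicit Defensive.

Local Open Scope classical_set_scope.
Local Open Scope ring_scope.

Definition Gamma {R : realType} (x : R) : R :=
  \int[@lebesgue_measure R]_(t in `]0, +oo[) (t `^ (x - 1) * expR (- t)).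

Definition inner_integral {R : realType} (d : nat) (m r rho : R) : \bar R :=
  (\int[@lebesgue_measure R]_(s in `]0%R, Num.sqrt (Num.min rho (r - rho))%R[)
    (expR (- m * s ^+ 2) * s ^+ (d - 2))%:E)%E.

(* The integrals of nonnegative functions are taken in [0, +oo], so that they
   exist for every measurable nonnegative profile g. The integration domains are
   open, so that g is evaluated only on ]0, +oo[: r^(-gamma) has no value at 0,
   while powR is total. *)
Definition G_step {R : realType} (d : nat) (m : R) (g : R -> R)
    (F : R -> \bar R) (r : R) : \bar R :=
  if r <= 0 then 0%E
  else if d == 1 :> nat then
    ((g r)^-1%:E *
     \int[@lebesgue_measure R]_(rho in `]0%R, r[)
       ((g (r - rho) * g rho)%:E * F rho))%E
  else
    ((g r * r `^ ((d%:R - 1) / 2))^-1%:E *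
     \int[@lebesgue_measure R]_(rho in `]0%R, r[)
       (inner_integral d m r rho *
        (g (r - rho) * (r - rho) `^ ((d%:R - 1) / 2) *
         (g rho * rho `^ ((d%:R - 1) / 2)))%:E * F rho))%E.

(* Indexed from n = 1; the value at n = 0 is irrelevant. *)
Definition G {R : realType} (d : nat) (m : R) (g : R -> R) (n : nat) :
    R -> \bar R :=
  iter n.-1 (G_step d m g) (fun=> 1%E).

Definition C_const {R : realType} (d : nat) (m r0 : R) : R :=
  if d == 1 :> nat then 1 else expR (- m * r0) / (d%:R - 1).

Definition frac_part {R : realType} (b : R) : R := b - (Num.floor b)%:~R.

Definition R_const {R : realType} (a0 b : R) : R :=
  (8 * ((Num.ceil b)%:~R ^ Num.floor b) / a0 `^ (1 - frac_part b)) `^ (1 / a0) *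
  (2 `^ (1 / a0) * expR 1 `^ (1 / expR 1)) ^ (2 * Num.floor b).

(* Main.v *)
Require Import Defs.
From mathcomp Require Import measurable_realfun zify ring lra.

(** Write D = (d - 1) / 2, take a profile g(s) = s^(-p) max(1, s)^(-q) with
    p < d and q >= 0, and put a = d - p. Both halves of the theorem are instances:
    (p, q) = (gamma, 0) and (p, q) = (0, gamma). The idea is to bound the kernel
    of the recursion below by a pure product of powers of rho and r - rho, so
    that every step of the recursion becomes an Euler Beta integral.

    The inner integral runs up to sqrt(min(rho, r - rho)), and
    min(rho, r - rho, 1) >= rho (r - rho) / (r max(1, r)). Stopping at the square
    root of the right-hand side, where exp(-m s^2) >= exp(-m), shows that the
    inner integral is at least C(1) (rho (r - rho) / (r max(1, r)))^D, with
    C(1) = exp(-m) / (d - 1); for d = 1 the kernel is 1 = C(1). Bounding also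
    every negative power of max(1, rho) and max(1, r - rho) below by the same
    power of max(1, r), one gets by induction on n, for all r > 0 simultaneously,

      G_n(r) >= C(1)^(n-1) Gamma(a)^n / Gamma(a n)
                  * (r^a max(1, r)^(-(q + D)))^(n-1).

    The induction has to include small r, since G_(n+1)(r) involves G_n on the
    whole of ]0, r[; the factor max(1, r) separates the two growth regimes, r^a for
    r <= 1 and r^((d+1)/2 - p - q) for r >= 1. The step is the identity
    int_0^r (r - x)^(a-1) x^(an-1) dx
      = Gamma(a) Gamma(an) / Gamma(a(n+1)) r^(a(n+1)-1),
    proved in [integral_Beta]; the bound itself is [G_ge]. As R(a_0, b) >= 1
    ([R_const_ge1]) and C is nonincreasing, C(R(a_0, b)) / 2 <= C(1), which
    gives the theorem ([G_ge_powR]).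

    The Beta identity is obtained from Tonelli applied to
    Gamma(a) Gamma(b), with the linear changes of variables provided by
    [ge0_integral_affine]. It needs Gamma to be finite and positive on
    ]0, +oo[ ([integral_Gamma], [Gamma_gt0]). *)

Set Implicit Arguments.
Unset Strict Implicit.
Unset Printing Implicit Defensive.

Local Open Scope classical_set_scope.
Local Open Scope ring_scope.

(** * Lebesgue integrals on the line *)

(** The integral of a nonnegative function is a supremum over the simple
    functions below it, so monotonicity holds without measurability. This spares
    proving that the functions [G d m g n] are measurable. *)
Lemma ge0_le_integral_nonmeasurable (disp : measure_display)
    (T : measurableType disp) (R : realType) (mu : {measure set T -> \bar R})
    (D : set T) (f1 f2 : T -> \bar R) :
  (forall x, D x -> 0 <= f1 x)%E -> (forall x, D x -> f1 x <= f2 x)%E ->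
  (\int[mu]_(x in D) f1 x <= \int[mu]_(x in D) f2 x)%E.
Proof.
move=> f10 f12.
have f20 x : D x -> (0 <= f2 x)%E.
  by move=> Dx; exact: le_trans (f10 _ Dx) (f12 _ Dx).
rewrite !ge0_integralE//; apply: ge_ereal_sup => _ [h/= hf1 <-].
apply: ereal_sup_ubound; exists h => // x.
by apply: le_trans (hf1 x) _; exact: lee_restrict.
Qed.

(** Lebesgue measure and c times its pushforward by x |-> c x + e agree on
    half-open intervals, hence on all measurable sets. *)
Lemma ge0_integral_affine (R : realType) (c e : R) (f : R -> \bar R) :
  0 < c -> measurable_fun [set: R] f -> (forall x, 0 <= f x)%E ->
  (\int[@lebesgue_measure R]_x f x =
   c%:E * \int[@lebesgue_measure R]_x f (c * x + e)%R)%E.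
Proof.
move=> c0 mf f0.
pose phi (x : measurableTypeR R) : measurableTypeR R := c * x + e.
have mphi : measurable_fun setT phi by exact: measurable_funD.
pose k : {nonneg R} := NngNum (ltW c0).
pose nu : {measure set (measurableTypeR R) -> \bar R} :=
  measure_function_pushforward__canonical__measure_function_Measure
    (@lebesgue_measure R) mphi.
rewrite (eq_measure_integral (mscale k nu)).
  by rewrite ge0_integral_mscale//= ge0_integral_pushforward.
move=> A mA _; apply: lebesgue_measure_unique mA => _ [[a b] _ <-] /=.
rewrite /mscale /= /pushforward.
have -> : phi @^-1` `]a, b]%classic = `](a - e) / c, (b - e) / c]%classic.
  apply/seteqP; split => x /=; rewrite !in_itv/= /phi => /andP[H1 H2];
    apply/andP; split.
  - by rewrite ltr_pdivrMr// ltrBlDr mulrC.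
  - by rewrite ler_pdivlMr// lerBrDr mulrC.
  - by move: H1; rewrite ltr_pdivrMr// ltrBlDr mulrC.
  - by move: H2; rewrite ler_pdivlMr// lerBrDr mulrC.
rewrite !lebesgue_measure_itv/= !lte_fin ltr_pM2r ?invr_gt0// ltrD2r.
case: ifP => _; last by rewrite mule0.
by rewrite -!EFinD -EFinM; congr EFin; field; rewrite gt_eqF.
Qed.

(** The integral is improper at both ends. The fundamental theorem of calculus
    bounds the integral over [1 / (n + 1), n + 2] by the increment of [F], and
    these intervals exhaust ]0, +oo[. *)
Lemma ge0_integral_derivative_le (R : realType) (F f : R -> R) (M : R) :
  (forall x : R, 0 < x -> is_derive x 1 F (f x)) ->
  {in `]0, +oo[, continuous f} ->
  (forall x : R, 0 < x -> 0 <= f x) ->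
  (forall x : R, 0 < x -> 0 <= F x <= M) ->
  (\int[@lebesgue_measure R]_(x in `]0%R, +oo[) (f x)%:E <= M%:E)%E.
Proof.
move=> dF cf f0 FM.
pose J n : set R := `[n.+1%:R^-1, n.+2%:R]%classic.
have J0 n x : J n x -> 0 < x.
  by rewrite /J/= in_itv/= => /andP[+ _]; apply: lt_le_trans; rewrite invr_gt0.
have UJ : `]0%R, +oo[%classic = \bigcup_n J n.
  apply/seteqP; split => [x/=|x [n _]]; last first.
    by move=> /J0 x0; rewrite /= in_itv/= x0.
  rewrite in_itv/= andbT => x0.
  have [N1 xN1] : exists N, x^-1 <= N%:R :> R.
    by exists (Num.truncn x^-1).+1; exact: ltW (truncnS_gt _).
  have [N2 xN2] : exists N, x <= N%:R :> R.
    by exists (Num.truncn x).+1; exact: ltW (truncnS_gt _).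
  exists (maxn N1 N2) => //; rewrite /J/= in_itv/=; apply/andP; split.
    rewrite invf_ple ?posrE//; apply: le_trans xN1 _.
    by rewrite ler_nat (leq_trans (leq_maxl _ N2)).
  by apply: le_trans xN2 _; rewrite ler_nat (leq_trans (leq_maxr N1 _))//
    2?leqW.
have mf : measurable_fun (`]0%R, +oo[%classic : set R) f.
  apply: open_continuous_measurable_fun => //.
  by move=> x; rewrite inE => /cf.
have sJ n : J n `<=` (`]0%R, +oo[%classic : set R).
  by move=> x /J0 x0; rewrite /= in_itv/= x0.
have cvJ := @ge0_nondecreasing_set_cvg_integral _ (measurableTypeR R) R J
  (EFin \o f) (@lebesgue_measure R).
rewrite UJ.
have {}cvJ : (\int[lebesgue_measure]_(x in J i) (f x)%:E @[i --> \oo] -->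
   \int[lebesgue_measure]_(x in \bigcup_i J i) (f x)%:E)%E.
  apply: cvJ => //.
  - apply/nondecreasing_seqP => n; rewrite subsetEset => x.
    rewrite /J/= !in_itv/= => /andP[H1 H2]; apply/andP; split.
      by apply: le_trans H1; rewrite lef_pV2 ?posrE// ler_nat.
    by apply: le_trans H2 _; rewrite ler_nat.
  - by move=> n; rewrite /J; exact: measurable_itv.
  - move=> n; apply/measurable_EFinP; apply: measurable_funS mf => //.
  - by move=> n x /J0 x0; rewrite /= lee_fin f0.
rewrite -(cvg_lim _ cvJ)//; apply: lime_le.
  by apply/cvg_ex; eexists; exact: cvJ.
apply: nearW => n.
have n1 : n.+1%:R^-1 < n.+2%:R :> R.
  by apply: (@le_lt_trans _ _ 1); rewrite ?ltr1n// invf_le1// ler1n.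
have n0 : (0 : R) < n.+1%:R^-1 by rewrite invr_gt0.
have cF (x : R) : 0 < x -> {for x, continuous F}.
  move=> x0; apply: differentiable_continuous; apply/derivable1_diffP.
  by have := dF _ x0 => -[].
have -> : (\int[lebesgue_measure]_(x in J n) (f x)%:E =
   (F n.+2%:R)%:E - (F n.+1%:R^-1)%:E)%E.
  apply: continuous_FTC2 => //.
  - apply: continuous_in_subspaceT => x; rewrite inE => /sJ.
    by move=> ?; apply: cf; rewrite inE.
  - split.
    + move=> x; rewrite in_itv/= => /andP[/(lt_trans n0) x0 _].
      by have := dF _ x0 => -[].
    + by apply: cvg_at_right_filter; exact: cF.
    + by apply: cvg_at_left_filter; exact: cF.
  - move=> x; rewrite in_itv/= => /andP[/(lt_trans n0) x0 _].
    by have := dF _ x0 => -[_]; rewrite derive1E.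
rewrite -EFinB lee_fin.
have /andP[_ ?] := FM n.+2%:R (ltr0Sn _ _).
have /andP[? _] := FM _ n0.
lra.
Qed.

Lemma integral_exprn (R : realType) (k : nat) (T : R) : 0 < T ->
  (\int[@lebesgue_measure R]_(s in `]0%R, T[) (s ^+ k)%:E =
   (T ^+ k.+1 / k.+1%:R)%:E)%E.
Proof.
move=> T0.
rewrite -(@integral_itv_bndoo _ _ _ _ true false); last first.
  by apply/measurable_EFinP; exact: measurable_funTS.
have dF (x : R) : is_derive x 1 (fun s : R => s ^+ k.+1 / k.+1%:R) (x ^+ k).
  have -> : (fun s : R => s ^+ k.+1 / k.+1%:R) =
      k.+1%:R^-1 *: ((@id R) ^+ k.+1 : R -> R).
    by rewrite exprfctE scalrfctE; apply/funext => s; exact: mulrC.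
  apply: is_derive_eq; rewrite /GRing.scale/= mulr1.
  by rewrite mulrA mulVf ?mul1r ?pnatr_eq0.
have cF : continuous (fun s : R => s ^+ k.+1 / k.+1%:R).
  move=> x; apply: differentiable_continuous; apply/derivable1_diffP.
  by have := dF x => -[].
rewrite (@continuous_FTC2 _ _ (fun s => s ^+ k.+1 / k.+1%:R))//.
- by rewrite expr0n/= mul0r sube0.
- by apply: continuous_subspaceT => x; exact: exprn_continuous.
- split.
  + by move=> x _; have := dF x => -[].
  + by apply: cvg_at_right_filter; exact: cF.
  + by apply: cvg_at_left_filter; exact: cF.
- by move=> x _; have := dF x => -[_]; rewrite derive1E.
Qed.

(** * Convergence and positivity of the Gamma integral *)

(** With N > x integer, t^x <= 1 + t^N and t^N <= N! 2^N exp(t / 2) by the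
    exponential series; the exponent t / 2 leaves room for the square. *)
Lemma sqr_addr_powR_le_expR (R : realType) (x : R) : 0 < x ->
  exists2 K : R, 0 <= K & forall t : R, 0 < t -> (1 + t `^ x) ^+ 2 <= K * expR t.
Proof.
move=> x0; set N := Num.truncn x.
have xN : x <= N.+1%:R by exact: ltW (truncnS_gt _).
pose c : R := 2 + N.+1`!%:R * 2 ^+ N.+1.
have c0 : 0 <= c by rewrite /c addr_ge0// mulr_ge0// exprn_ge0.
exists (c ^+ 2) => [|t t0]; first by rewrite exprn_ge0.
suff H : 1 + t `^ x <= c * expR (t / 2).
  have -> : expR t = expR (t / 2) ^+ 2.
    by rewrite -expRM_natl; congr expR; field.
  by rewrite -exprMn ler_sqr// nnegrE ?addr_ge0 ?powR_ge0 ?mulr_ge0 ?expR_ge0.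
have tx : t `^ x <= 1 + t ^+ N.+1.
  have [t1|/ltW t1] := leP t 1.
    apply: (@le_trans _ _ 1); last by rewrite lerDl exprn_ge0// ltW.
    by rewrite -[leRHS](powRr0 t); apply: ger_powR; rewrite ?t0 ?t1// ltW.
  apply: (@le_trans _ _ (t ^+ N.+1)); last by rewrite lerDr.
  by rewrite -powR_mulrn ?(ltW t0)//; exact: ler_powR.
have e1 : 1 <= expR (t / 2) by rewrite -expR0 ler_expR divr_ge0 ?ltW.
have eN : t ^+ N.+1 <= N.+1`!%:R * 2 ^+ N.+1 * expR (t / 2).
  have /(_ N) H := @expR_ge1Dxn R (t / 2) _ (divr_ge0 (ltW t0) (ler0n _ _)).
  rewrite -ler_pdivrMl; last by rewrite mulr_gt0 ?exprn_gt0// ltr0n fact_gt0.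
  apply: le_trans H; rewrite -[leLHS]add0r lerD// expr_div_n invfM.
  by rewrite mulrC mulrA mulrAC.
rewrite /c mulrDl; lra.
Qed.

(** [Gamma] is a real-valued integral, hence carries the value 0 should the
    integral diverge; this lemma says that it converges. The comparison
    function is the derivative of 1 - 1 / (1 + t^a). The latter takes values in
    [0, 1], and its derivative behaves like t^(a-1) at 0 and decays only
    polynomially at infinity, so that a multiple of it dominates the integrand
    at both ends. *)
Lemma integral_Gamma (R : realType) (a : R) : 0 < a ->
  (\int[@lebesgue_measure R]_(t in `]0%R, +oo[) (t `^ (a - 1) * expR (- t))%:E =
   (Gamma a)%:E)%E.
Proof.
move=> a0.
pose h (t : R) := a * t `^ (a - 1) / (1 + t `^ a) ^+ 2.
have p1 (t : R) : 0 < 1 + t `^ a by rewrite ltr_wpDr ?powR_ge0.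
have cpow (b t : R) : 0 < t -> {for t, continuous (fun s : R => s `^ b)}.
  move=> t0; apply: differentiable_continuous; apply/derivable1_diffP.
  by have := is_derive1_powR b t0 => -[].
have h0 (t : R) : 0 < t -> 0 <= h t.
  by move=> t0; rewrite /h divr_ge0 ?exprn_ge0 ?mulr_ge0 ?powR_ge0 ?ltW.
have ch : {in `]0, +oo[, continuous h}.
  move=> t; rewrite in_itv/= andbT => t0; rewrite /h.
  apply: cvgM; first by apply: cvgM; [exact: cvg_cst|exact: cpow].
  apply: cvgV; first by rewrite expf_neq0// gt_eqF.
  rewrite expr2.
  apply: (@cvgM _ _ _ _ (fun s : R => 1 + s `^ a) (fun s : R => 1 + s `^ a));
    apply: cvgD; (exact: cvg_cst || exact: cpow).
have Hh : (\int[@lebesgue_measure R]_(t in `]0%R, +oo[) (h t)%:E <= 1%:E)%E.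
  apply: (@ge0_integral_derivative_le _ (fun t => 1 - (1 + t `^ a)^-1)) => //.
    move=> t t0.
    have d1 : is_derive t 1 (cst 1 + (fun s : R => s `^ a) : R -> R)
        (0 + a * t `^ (a - 1)).
      by apply: is_deriveD; exact: is_derive1_powR.
    have n0 : (cst 1 + (fun s : R => s `^ a) : R -> R) t != 0.
      by rewrite gt_eqF//; exact: p1.
    have d2 := is_deriveV n0 d1.
    have d3 := is_deriveB (is_derive_cst (1 : R) t 1) d2.
    apply: (is_derive_eq d3).
    rewrite /h /GRing.scale/= !fctE; field.
    by rewrite gt_eqF//; exact: p1.
  move=> t t0; have := p1 t; set p := 1 + _ => pp.
  rewrite subr_ge0 invf_le1// lerDl powR_ge0/=.
  by rewrite gerBl invr_ge0 ltW.
rewrite /Gamma /Rintegral fineK//.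
have [K K0 HK] := sqr_addr_powR_le_expR a0.
have mg : measurable_fun (setT : set R) (fun t : R => t `^ (a - 1) * expR (- t)).
  apply: measurable_funM; first exact: measurable_powR.
  by apply: measurableT_comp => //; exact: measurable_expR.
rewrite ge0_fin_numE; last first.
  by apply: integral_ge0 => t _; rewrite lee_fin mulr_ge0 ?powR_ge0 ?expR_ge0.
apply: (@le_lt_trans _ _
   (\int[@lebesgue_measure R]_(t in `]0%R, +oo[) ((K / a)%:E * (h t)%:E))%E).
  apply: ge0_le_integral_nonmeasurable => t /=.
    by rewrite lee_fin mulr_ge0 ?powR_ge0 ?expR_ge0.
  rewrite in_itv/= andbT => t0; rewrite -EFinM lee_fin.
  have -> : K / a * h t = t `^ (a - 1) * (K / (1 + t `^ a) ^+ 2).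
    by rewrite /h; field; rewrite !gt_eqF//; exact: p1.
  rewrite ler_wpM2l ?powR_ge0// ler_pdivlMr ?exprn_gt0//.
  by rewrite mulrC expRN ler_pdivrMr ?expR_gt0// HK.
rewrite ge0_integralZl//.
- apply: (@le_lt_trans _ _ ((K / a)%:E * 1%:E)%E); last by rewrite -EFinM ltry.
  by apply: lee_pmul => //; [rewrite lee_fin divr_ge0// ltW
     |apply: integral_ge0 => t; rewrite /= in_itv/= andbT lee_fin => /h0].
- apply/measurable_EFinP; apply: open_continuous_measurable_fun => //.
  by move=> t; rewrite inE => /ch.
- by move=> t; rewrite /= in_itv/= andbT lee_fin => /h0.
- by rewrite lee_fin divr_ge0// ltW.
Qed.

Lemma Gamma_gt0 (R : realType) (a : R) : 0 < a -> 0 < Gamma a.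
Proof.
move=> a0; rewrite -lte_fin -integral_Gamma//.
(* a lower bound of the integrand on [1, 2], whatever the sign of a - 1 *)
pose k : R := Num.min 1 (2 `^ (a - 1)) * expR (- 2).
have k0 : 0 < k by rewrite mulr_gt0 ?expR_gt0// lt_min ltr01/= powR_gt0.
apply: (@lt_le_trans _ _ (\int[@lebesgue_measure R]_(t in `[1%R, 2%R]) k%:E)%E).
  rewrite integral_cst//= lebesgue_measure_itv/= lte_fin ltr1n -EFinD -EFinM.
  by rewrite lte_fin mulr_gt0//; lra.
have mg : measurable_fun (setT : set R) (fun t : R => t `^ (a - 1) * expR (- t)).
  apply: measurable_funM; first exact: measurable_powR.
  by apply: measurableT_comp => //; exact: measurable_expR.
apply: (@le_trans _ _ (\int[@lebesgue_measure R]_(t in `[1%R, 2%R])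
    (t `^ (a - 1) * expR (- t))%:E)%E).
  apply: ge0_le_integral_nonmeasurable => t /=; first by rewrite lee_fin ltW.
  rewrite in_itv/= => /andP[t1 t2]; rewrite lee_fin.
  apply: ler_pM; rewrite ?expR_ge0 ?ler_expR ?lerN2//.
  have [a1|a1] := leP 0 (a - 1).
    rewrite ge_min; apply/orP; left; rewrite -[leLHS](powRr0 t).
    exact: ler_powR.
  rewrite ge_min; apply/orP; right.
  have t0 : 0 < t := lt_le_trans ltr01 t1.
  rewrite -[a - 1]opprB !powRN lef_pV2 ?posrE ?powR_gt0//.
  by apply: ge0_ler_powR; rewrite ?nnegrE// ?subr_ge0; lra.
apply: ge0_subset_integral => //=.
- by apply/measurable_EFinP; exact: measurable_funTS.
- by move=> t _; rewrite lee_fin mulr_ge0 ?powR_ge0 ?expR_ge0.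
- by move=> t /=; rewrite !in_itv/= andbT => /andP[+ _]; apply: lt_le_trans.
Qed.

(** * The Beta integral *)

(** The Gamma and Beta integrands are extended by 0 to the whole line: the
    convolution below then vanishes off ]0, u[ by itself, and Tonelli and the
    changes of variables need no bookkeeping of domains. *)
Definition half_powR (R : realType) (a x : R) : R :=
  if 0 < x then x `^ (a - 1) else 0.

Lemma half_powR_ge0 (R : realType) (a x : R) : 0 <= half_powR a x.
Proof. by rewrite /half_powR; case: ifP => // _; exact: powR_ge0. Qed.

Lemma measurable_half_powR (R : realType) (a : R) :
  measurable_fun [set: R] (half_powR a).
Proof.
apply: measurable_fun_ifT => //.
exact: measurable_fun_ltr.
Qed.

Lemma half_powRM (R : realType) (a u x : R) : 0 < u ->
  half_powR a (u * x) = u `^ (a - 1) * half_powR a x.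
Proof.
move=> u0; rewrite /half_powR pmulr_rgt0//; case: ifP => x0; last by rewrite mulr0.
by rewrite powRM// ltW.
Qed.

(** For u > 0 this is the Beta integral over ]0, u[. It is kept in [\bar R],
    its finiteness being a consequence of its value at u = 1. *)
Definition convol_powR (R : realType) (a b u : R) : \bar R :=
  (\int[@lebesgue_measure R]_y (half_powR a (u - y)%R * half_powR b y)%:E)%E.

Lemma measurable_convol_integrand (R : realType) (a b : R) :
  measurable_fun [set: R * R]
    (fun z : R * R => half_powR a (z.1 - z.2) * half_powR b z.2).
Proof.
apply: measurable_funM.
  apply: (measurableT_comp (measurable_half_powR a)).
  exact: measurable_funB.
exact: (measurableT_comp (measurable_half_powR b)).
Qed.

Lemma convol_powR_le0 (R : realType) (a b u : R) : u <= 0 ->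
  convol_powR a b u = 0%E.
Proof.
move=> u0; rewrite /convol_powR integral0_eq// => y _.
rewrite /half_powR; case: ifP => // y1; case: ifP => // y0; rewrite ?mulr0 ?mul0r//.
by exfalso; lra.
Qed.

Lemma convol_powR_scale (R : realType) (a b u : R) : 0 < u ->
  (convol_powR a b u = (u `^ (a + b - 1))%:E * convol_powR a b 1)%E.
Proof.
move=> u0; rewrite /convol_powR.
have m (v : R) : measurable_fun [set: R]
    (fun y : R => (half_powR a (v - y) * half_powR b y)%:E).
  apply/measurable_EFinP; apply: measurable_funM.
    apply: (measurableT_comp (measurable_half_powR a)).
    exact: measurable_funB.
  exact: (measurable_half_powR b).
have p (v y : R) : (0 <= (half_powR a (v - y) * half_powR b y)%:E)%E.
  by rewrite lee_fin mulr_ge0// half_powR_ge0.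
rewrite (@ge0_integral_affine _ u 0)//.
under eq_integral => y _.
  rewrite addr0 (_ : u - u * y = u * (1 - y)); last by ring.
  rewrite !half_powRM// mulrACA EFinM.
  over.
rewrite ge0_integralZl//; last by rewrite lee_fin mulr_ge0 ?powR_ge0.
rewrite muleA -EFinM; congr (_%:E * _)%E.
have u1 : u != 0 by rewrite gt_eqF.
rewrite -[X in X * _](powRr1 (ltW u0)) -!powRD ?u1 ?implybT//.
  by congr (_ `^ _); ring.
exact: m.
Qed.

Lemma integral_half_powR_expR (R : realType) (a : R) : 0 < a ->
  (\int[@lebesgue_measure R]_x (half_powR a x * expR (- x)%R)%:E =
   (Gamma a)%:E)%E.
Proof.
move=> a0; rewrite -integral_Gamma// [RHS]integral_mkcond.
apply: eq_integral => x _; rewrite patchE mem_setE in_itv/= andbT /half_powR.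
by case: ifP => // _; rewrite mul0r.
Qed.

(** Both sides of Gamma(a) Gamma(b) = B(a, b) Gamma(a + b) are the integral over
    (u, y) of (u - y)^(a-1) y^(b-1) exp(-u): integrating in u first is, up to a
    translation by y, the Gamma integral, while integrating in y first gives the
    convolution at u, that is, u^(a+b-1) B(a, b). *)
Lemma convol_powR_Gamma (R : realType) (a b : R) : 0 < a -> 0 < b ->
  convol_powR a b 1 = (Gamma a * Gamma b / Gamma (a + b))%:E.
Proof.
move=> a0 b0.
have mexp : measurable_fun [set: R] (fun y : R => expR (- y)).
  by apply: measurableT_comp => //; exact: measurable_expR.
have mh c : measurable_fun [set: R] (fun x : R => half_powR c x * expR (- x)).
  by apply: measurable_funM => //; exact: measurable_half_powR.
have mhE c : measurable_fun [set: R] (fun x : R => (half_powR c x * expR (- x))%:E).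
  exact/measurable_EFinP.
have h0 c (x : R) : (0 <= (half_powR c x * expR (- x))%:E)%E.
  by rewrite lee_fin mulr_ge0 ?half_powR_ge0 ?expR_ge0.
pose F (z : R * R) : R := half_powR a (z.1 - z.2) * half_powR b z.2 * expR (- z.1).
have mF : measurable_fun [set: R * R] F.
  apply: measurable_funM; first exact: measurable_convol_integrand.
  exact: (measurableT_comp mexp).
have F0 z : (0 <= (F z)%:E)%E.
  by rewrite lee_fin !mulr_ge0 ?half_powR_ge0 ?expR_ge0.
(* An infinite Beta integral is excluded by this identity, since its left-hand
   side is finite and Gamma (a + b) > 0. *)
have E : ((Gamma a)%:E * (Gamma b)%:E =
    convol_powR a b 1 * (Gamma (a + b))%:E)%E.
  transitivity (\int[@lebesgue_measure R]_y \int[@lebesgue_measure R]_u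
      (F (u, y))%:E)%E.
    rewrite -(integral_half_powR_expR b0) -ge0_integralZl//; last 2 first.
    - exact: mhE.
    - by rewrite lee_fin ltW// Gamma_gt0.
    apply: eq_integral => y _.
    rewrite -(integral_half_powR_expR a0) muleC -ge0_integralZl//; last 1 first.
    - exact: mhE.
    rewrite [LHS](@ge0_integral_affine _ 1 (- y))//; last 2 first.
    - apply/measurable_EFinP; exact: measurable_funM.
    - by move=> x; apply: mule_ge0.
    rewrite mul1e; apply: eq_integral => u _; rewrite mul1r -EFinM; congr EFin.
    rewrite /F/= mulrACA mulrC [in RHS]mulrC; congr (_ * _).
      by rewrite -expRD; congr expR; ring.
    by rewrite mulrC.
  have := @fubini_tonelli _ _ (measurableTypeR R) (measurableTypeR R) R
    (@lebesgue_measure R) (@lebesgue_measure R) (EFin \o F).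
  move=> <-//; last exact/measurable_EFinP.
  rewrite -(@integral_half_powR_expR _ (a + b)) ?addr_gt0//.
  rewrite -ge0_integralZl//; last 2 first.
  - exact: mhE.
  - by apply: integral_ge0 => y _; rewrite lee_fin mulr_ge0 ?half_powR_ge0.
  apply: eq_integral => u _ /=.
  transitivity (convol_powR a b u * (expR (- u))%:E)%E.
    rewrite muleC /convol_powR -ge0_integralZl//.
    - by apply: eq_integral => y _; rewrite /F/= -EFinM mulrC.
    - apply/measurable_EFinP; apply: measurable_funM.
        apply: (measurableT_comp (measurable_half_powR a)).
        exact: measurable_funB.
      exact: (measurable_half_powR b).
    - by move=> y _; rewrite lee_fin mulr_ge0// half_powR_ge0.
  have [u0|u0] := ltP 0 u; last first.
    by rewrite convol_powR_le0// mul0e /half_powR ltNge u0/= mul0r mule0.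
  by rewrite convol_powR_scale// /half_powR u0 EFinM muleA
    [(convol_powR a b 1 * _)%E]muleC.
have g0 := Gamma_gt0 (addr_gt0 a0 b0).
have c0 : (0 <= convol_powR a b 1)%E.
  by apply: integral_ge0 => y _; rewrite lee_fin mulr_ge0 ?half_powR_ge0.
move: E c0; case: (convol_powR a b 1) => [c| |] //.
- rewrite -!EFinM => -[->] _; rewrite mulfK// gt_eqF//.
- by rewrite gt0_mulye// lte_fin.
Qed.

Lemma integral_Beta (R : realType) (a b r : R) : 0 < a -> 0 < b -> 0 < r ->
  (\int[@lebesgue_measure R]_(x in `]0%R, r[)
     ((r - x) `^ (a - 1) * x `^ (b - 1))%:E =
   (Gamma a * Gamma b / Gamma (a + b) * r `^ (a + b - 1))%:E)%E.
Proof.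
move=> a0 b0 r0.
rewrite EFinM -convol_powR_Gamma// muleC -convol_powR_scale// integral_mkcond.
apply: eq_integral => x _; rewrite patchE mem_setE in_itv/= /half_powR subr_gt0.
by case: (0 < x); case: (x < r); rewrite ?mulr0 ?mul0r.
Qed.

(** * Lower bounds for the recursion *)

Lemma powR_expR_ln (R : realType) (x y : R) : 0 < x -> x `^ y = expR (y * ln x).
Proof. by move=> x0; rewrite /powR gt_eqF. Qed.

Lemma powRN_le (R : realType) (x y q : R) : 0 < x -> x <= y -> 0 <= q ->
  y `^ (- q) <= x `^ (- q).
Proof.
move=> x0 xy q0; have y0 := lt_le_trans x0 xy.
rewrite !powRN lef_pV2 ?posrE ?powR_gt0//.
by apply: ge0_ler_powR; rewrite // nnegrE ltW.
Qed.

Lemma powR_ge1 (R : realType) (x y : R) : 1 <= x -> 0 <= y -> 1 <= x `^ y.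
Proof. by move=> x1 y0; rewrite -[leLHS](powRr0 x); exact: ler_powR. Qed.

(** The only delicate factor is 8 ceil(b)^floor(b) / a0^(1 - {b}). If a0 <= 1,
    the denominator is at most 1; otherwise 1 < a0 <= b, the denominator is at
    most a0 <= ceil(b), and floor(b) >= 1. *)
Lemma R_const_ge1 (R : realType) (a0 b : R) : 0 < a0 -> 0 < b ->
  a0 <= 1 \/ a0 <= b -> 1 <= R_const a0 b.
Proof.
move=> a00 b0 ab; rewrite /R_const /frac_part.
have [k kE] : exists k : nat, Num.floor b = k.
  by exists `|Num.floor b|%N; rewrite gez0_abs// floor_ge0 ltW.
have kb : k%:R <= b by have := floor_le b; rewrite kE.
have bk : b < k%:R + 1 by have := floorD1_gt b; rewrite kE intrD.
rewrite kE.
have c1 : 1 <= (Num.ceil b)%:~R :> R.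
  by rewrite ler1z -gtz0_ge1 ceil_gt0.
have cb : b <= (Num.ceil b)%:~R by exact: ceil_ge.
have f1 : k%:~R = k%:R :> R by [].
have e1 : 1 <= expR 1 :> R by rewrite -[leLHS]expR0 ler_expR.
rewrite f1; apply: mulr_ege1; last first.
  rewrite (_ : 2 * Posz k = Posz (2 * k))//; apply: exprn_ege1.
  apply: mulr_ege1; apply: powR_ge1; rewrite ?ler1n// divr_ge0 ?expR_ge0//.
  exact: ltW.
apply: powR_ge1; last by rewrite divr_ge0// ltW.
rewrite -exprnP ler_pdivlMr ?powR_gt0// mul1r.
have ck : 1 <= (Num.ceil b)%:~R ^+ k :> R by exact: exprn_ege1.
have [a1|a1] := leP a0 1.
  apply: (@le_trans _ _ 1); last by lra.
  rewrite -[leRHS](powRr0 a0); apply: ger_powR; first by rewrite a00.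
  lra.
have {}ab : a0 <= b by case: ab => //; rewrite leNgt a1.
have ac : a0 `^ (1 - (b - k%:R)) <= a0.
  by rewrite -[leRHS](powRr1 (ltW a00)); apply: ler_powR; lra.
have kc : (Num.ceil b)%:~R <= (Num.ceil b)%:~R ^+ k :> R.
  apply: ler_eXnr => //; case: k bk {kE kb f1 ck ac} => // bk; lra.
lra.
Qed.

Lemma C_const_ge0 (R : realType) (d : nat) (m r0 : R) : (1 <= d)%N ->
  0 <= C_const d m r0.
Proof.
move=> d1; rewrite /C_const; case: ifP => // _.
by rewrite divr_ge0 ?expR_ge0// subr_ge0 ler1n.
Qed.

Lemma C_const_anti (R : realType) (d : nat) (m r0 r1 : R) : (1 <= d)%N ->
  0 <= m -> r0 <= r1 -> C_const d m r1 <= C_const d m r0.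
Proof.
move=> d1 m0 r01; rewrite /C_const; case: ifP => // _.
rewrite ler_wpM2r ?invr_ge0 ?subr_ge0 ?ler1n// ler_expR.
by rewrite !mulNr lerN2 ler_wpM2l.
Qed.

(** On ]0, sqrt q[ one has exp(-m s^2) >= exp(-m), and the remaining integral of
    s^(d-2) is sqrt(q)^(d-1) / (d - 1). *)
Lemma inner_integral_ge (R : realType) (d : nat) (m r rho q : R) :
  (2 <= d)%N -> 0 <= m -> 0 < q -> q <= 1 -> q <= Num.min rho (r - rho) ->
  ((C_const d m 1 * q `^ ((d%:R - 1) / 2))%:E <= inner_integral d m r rho)%E.
Proof.
move=> d2 m0 q0 q1 qmin; rewrite /inner_integral.
set T := Num.sqrt q.
have T0 : 0 < T by rewrite sqrtr_gt0.
have T2 : T ^+ 2 = q by rewrite sqr_sqrtr// ltW.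
have TT : T <= Num.sqrt (Num.min rho (r - rho)).
  exact: ler_wsqrtr.
have mX : measurable_fun [set: R] (fun s : R => (s ^+ (d - 2))%:E).
  by apply/measurable_EFinP; exact: measurable_funX.
have -> : ((C_const d m 1 * q `^ ((d%:R - 1) / 2))%:E =
   \int[@lebesgue_measure R]_(s in `]0%R, T[)
     ((expR (- m))%:E * (s ^+ (d - 2))%:E))%E.
  rewrite ge0_integralZl//.
  - rewrite integral_exprn// -EFinM; congr EFin.
    have -> : ((d - 2).+1 = d - 1)%N by lia.
    rewrite /C_const ifF; last by lia.
    rewrite natrB ?(ltnW d2)// mulr1 -mulrA; congr (_ * _).
    rewrite mulrC; congr (_ / _).
    rewrite -powR_mulrn ?(ltW T0)// /T -powR12_sqrt ?(ltW q0)//.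
    by rewrite -powRrM natrB ?(ltnW d2)// mulrC.
  - exact: measurable_funTS.
  - move=> s /=; rewrite in_itv/= => /andP[s0 _].
    by rewrite lee_fin exprn_ge0// ltW.
apply: (@le_trans _ _ (\int[@lebesgue_measure R]_(s in `]0%R, T[)
     (expR (- m * s ^+ 2) * s ^+ (d - 2))%:E)%E).
  apply: ge0_le_integral_nonmeasurable => s /=; rewrite in_itv/= => /andP[s0 sT].
    by rewrite -EFinM lee_fin mulr_ge0 ?expR_ge0// exprn_ge0// ltW.
  rewrite -EFinM lee_fin ler_wpM2r ?exprn_ge0 ?(ltW s0)// ler_expR.
  rewrite mulNr lerN2 ler_piMr//; apply: le_trans q1; rewrite -T2.
  by rewrite ler_sqr ?nnegrE ltW.
apply: ge0_subset_integral => //=.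
- apply/measurable_EFinP; apply: measurable_funTS; apply: measurable_funM.
    apply: measurableT_comp => //.
    by apply: measurable_funM => //; exact: measurable_funX.
  exact: measurable_funX.
- move=> s; rewrite in_itv/= => /andP[s0 _].
  by rewrite lee_fin mulr_ge0 ?expR_ge0// exprn_ge0// ltW.
- move=> s /=; rewrite !in_itv/= => /andP[-> sT] /=.
  exact: lt_le_trans TT.
Qed.

(** A lower bound of min(x, r - x, 1) which, up to a factor depending on r only,
    is a product of powers of x and r - x: the integrand bounded with its help
    stays of Beta type. *)
Definition min_minorant (R : realType) (r x : R) : R :=
  x * (r - x) / (r * Num.max 1 r).

Lemma min_minorant_bounds (R : realType) (r x : R) : 0 < x -> x < r ->
  [/\ 0 < min_minorant r x, min_minorant r x <= 1 &
      min_minorant r x <= Num.min x (r - x)].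
Proof.
move=> x0 xr; rewrite /min_minorant; set M := Num.max 1 r.
have M1 : 1 <= M by rewrite le_max lexx.
have Mr : r <= M by rewrite le_max lexx orbT.
have rM : 0 < r * M by rewrite mulr_gt0//; lra.
split.
- by rewrite divr_gt0// mulr_gt0//; lra.
- by rewrite ler_pdivrMr// mul1r ler_pM//; lra.
- rewrite le_min !ler_pdivrMr//; apply/andP; split.
    by rewrite ler_wpM2l ?(ltW x0)//; nra.
  by rewrite mulrC ler_wpM2l//; [lra|nra].
Qed.

(** For d = 1 the exponent (d - 1) / 2 vanishes and the constant is 1, so that
    the same expression covers both branches of the recursion. *)
Lemma G_step_ge (R : realType) (d : nat) (m : R) (g : R -> R)
    (F : R -> \bar R) (L : R -> R) (r : R) :
  (1 <= d)%N -> 0 <= m -> 0 < r ->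
  (forall x, 0 < x -> 0 <= g x) ->
  (forall x, 0 < x < r -> 0 <= L x) ->
  (forall x, 0 < x < r -> ((L x)%:E <= F x)%E) ->
  (((g r * r `^ ((d%:R - 1) / 2))^-1)%:E *
     \int[@lebesgue_measure R]_(x in `]0%R, r[)
       (C_const d m 1 * min_minorant r x `^ ((d%:R - 1) / 2) *
        (g (r - x)%R * (r - x) `^ ((d%:R - 1) / 2) *
         (g x * x `^ ((d%:R - 1) / 2))) * L x)%:E <= G_step d m g F r)%E.
Proof.
move=> d1 m0 r0 g0 L0 LF; rewrite /G_step [r <= 0]leNgt r0/=.
have [dE|dE] := eqVneq d 1%N.
  rewrite dE subrr mul0r powRr0 mulr1 lee_wpmul2l ?lee_fin ?invr_ge0 ?g0//.
  apply: ge0_le_integral_nonmeasurable => x /=;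
    rewrite in_itv/= /C_const/= => /andP[x0 xr].
    by rewrite !powRr0 !mulr1 lee_fin !mulr_ge0// ?g0 ?L0 ?x0// subr_gt0.
  rewrite !powRr0 !mulr1 mul1r EFinM lee_wpmul2l ?LF ?x0//.
  by rewrite lee_fin mulr_ge0// g0// subr_gt0.
rewrite lee_wpmul2l ?lee_fin ?invr_ge0 ?mulr_ge0 ?powR_ge0 ?g0//.
apply: ge0_le_integral_nonmeasurable => x /=;
    rewrite in_itv/= => /andP[x0 xr].
  rewrite lee_fin !mulr_ge0// ?powR_ge0 ?C_const_ge0 ?g0 ?L0 ?x0//.
  by rewrite subr_gt0.
have [t0 t1 tm] := min_minorant_bounds x0 xr.
rewrite EFinM lee_pmul ?LF ?x0// ?lee_fin ?L0 ?x0//.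
  rewrite !mulr_ge0// ?powR_ge0 ?C_const_ge0 ?g0// subr_gt0//.
rewrite EFinM lee_wpmul2r//.
  by rewrite lee_fin !mulr_ge0// ?powR_ge0 ?g0// subr_gt0.
by apply: inner_integral_ge => //; lia.
Qed.

(** The radius is quantified inside the induction since the recursion at r uses
    all radii below r. After the factors max(1, .)^(-q) and the bound on [G] are
    made to depend on max(1, r) only, the integrand is a constant times
    (r - x)^(a-1) x^(a(n+1)-1), and the constants of the Beta integral
    telescope. *)
Lemma G_ge (R : realType) (d : nat) (m p q : R) (g : R -> R) :
  (1 <= d)%N -> 0 <= m -> p < d%:R -> 0 <= q ->
  (forall s, 0 < s -> g s = s `^ (- p) * Num.max 1 s `^ (- q)) ->
  forall (n : nat) (r : R), 0 < r ->
  ((C_const d m 1 ^+ n *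
    (Gamma (d%:R - p) ^+ n.+1 / Gamma ((d%:R - p) * n.+1%:R)) *
    (r `^ (d%:R - p) * Num.max 1 r `^ (- (q + (d%:R - 1) / 2))) ^+ n)%:E
   <= G d m g n.+1 r)%E.
Proof.
move=> d1 m0 pd q0 gE; set a := d%:R - p; set D := (d%:R - 1) / 2.
have a0 : 0 < a by rewrite subr_gt0.
have D0 : 0 <= D by rewrite divr_ge0// subr_ge0 ler1n.
have G0 (n : nat) : 0 < Gamma (a * n.+1%:R) by rewrite Gamma_gt0// mulr_gt0.
elim=> [|n IHn] r r0.
  by rewrite !expr0 mulr1 mul1r expr1 mulr1 divff// gt_eqF// Gamma_gt0.
set C := C_const d m 1 in IHn *.
have C0 : 0 <= C by exact: C_const_ge0.
(* K and A are introduced with equations rather than as local definitions, so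
   that the rewriting below does not unfold them *)
have [K KE] : exists K, K = C ^+ n * (Gamma a ^+ n.+1 / Gamma (a * n.+1%:R)).
  by eexists.
rewrite -KE in IHn.
have K0 : 0 <= K.
  by rewrite KE mulr_ge0 ?exprn_ge0// divr_ge0 ?exprn_ge0 ?ltW// Gamma_gt0.
pose L x := K * (x `^ a * Num.max 1 x `^ (- (q + D))) ^+ n.
have g0 x : 0 < x -> 0 <= g x by move=> x0; rewrite gE// mulr_ge0 ?powR_ge0.
have L0 x : 0 < x < r -> 0 <= L x.
  by move=> _; rewrite mulr_ge0// exprn_ge0// mulr_ge0 ?powR_ge0.
have LG x : 0 < x < r -> ((L x)%:E <= G d m g n.+1 x)%E.
  by move=> /andP[x0 _]; exact: IHn.
apply: le_trans (G_step_ge d1 m0 r0 g0 L0 LG).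
set M := Num.max 1 r.
have M0 : 0 < M by rewrite lt_max ltr01.
pose b := a * n.+1%:R.
have b0 : 0 < b by rewrite mulr_gt0.
have [A AE] : exists A,
    A = C * K * r `^ (- D) * M `^ (- D - q - q - (q + D) * n%:R) by eexists.
have A0 : 0 <= A by rewrite AE !mulr_ge0 ?powR_ge0.
have maxM x : 0 < x -> x < r -> Num.max 1 x <= M.
  by move=> x0 xr; rewrite ge_max !le_max lexx (ltW xr) orbT.
have max0 x : 0 < Num.max 1 x :> R by rewrite lt_max ltr01.
have gM x : 0 < x -> x < r -> x `^ (- p) * M `^ (- q) <= g x.
  move=> x0 xr; rewrite gE// ler_wpM2l ?powR_ge0//.
  by apply: powRN_le => //; exact: maxM.
apply: (@le_trans _ _ (((g r * r `^ D)^-1)%:E *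
   \int[@lebesgue_measure R]_(x in `]0%R, r[)
     (A%:E * ((r - x)%R `^ (a - 1) * x `^ (b - 1))%:E))%E); last first.
  rewrite lee_wpmul2l ?lee_fin ?invr_ge0 ?mulr_ge0 ?powR_ge0 ?g0//.
  apply: ge0_le_integral_nonmeasurable => x /=; rewrite in_itv/= => /andP[x0 xr].
    by rewrite -EFinM lee_fin !mulr_ge0 ?powR_ge0.
  have rx0 : 0 < r - x by rewrite subr_gt0.
  have rxr : r - x < r by rewrite ltrBlDr ltrDl.
  rewrite -EFinM lee_fin.
  apply: (@le_trans _ _ (C * min_minorant r x `^ D *
     (((r - x) `^ (- p) * M `^ (- q)) * (r - x) `^ D *
      ((x `^ (- p) * M `^ (- q)) * x `^ D)) *
     (K * (x `^ a * M `^ (- (q + D))) ^+ n))).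
    rewrite AE /min_minorant -/M le_eqVlt; apply/orP; left; apply/eqP.
    rewrite !powRM ?mulr_ge0 ?invr_ge0 ?mulr_ge0 ?ltW//.
    rewrite -!powR_inv1 ?mulr_ge0 ?ltW//.
    rewrite !powRM ?powR_ge0 ?ltW//.
    (* with all powers written as exponentials, the identity is linear in the
       logarithms *)
    rewrite !powR_expR_ln ?expR_gt0// !expRK.
    set lx := ln x; set lr := ln r; set lM := ln M; set lrx := ln (r - x).
    rewrite exprMn -!expRM_natl.
    transitivity ((C * K) * (expR (- D * lr) *
      expR ((- D - q - q - (q + D) * n%:R) * lM) * (expR ((a - 1) * lrx) *
      expR ((b - 1) * lx)))); first by ring.
    transitivity ((C * K) * (expR (D * lx) * expR (D * lrx) *
      (expR (D * (- 1 * lr)) * expR (D * (- 1 * lM))) *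
      (expR (- p * lrx) * expR (- q * lM) * expR (D * lrx) *
      (expR (- p * lx) * expR (- q * lM) * expR (D * lx))) *
      (expR (n%:R * (a * lx)) * expR (n%:R * (- (q + D) * lM))))); last by ring.
    rewrite -!expRD; congr (_ * expR _).
    by rewrite /b /a /D -natr1; field.
  rewrite /L; apply: ler_pM;
    rewrite ?mulr_ge0 ?powR_ge0 ?exprn_ge0 ?mulr_ge0 ?powR_ge0//.
    rewrite ler_wpM2l ?mulr_ge0 ?powR_ge0//.
    by apply: ler_pM; rewrite ?mulr_ge0 ?powR_ge0// ler_wpM2r ?powR_ge0 ?gM.
  rewrite ler_wpM2l// lerXn2r ?nnegrE ?mulr_ge0 ?powR_ge0//.
  rewrite ler_wpM2l ?powR_ge0//; apply: powRN_le; rewrite ?addr_ge0//.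
  exact: maxM.
rewrite ge0_integralZl//; last 2 first.
- apply/measurable_EFinP; apply: measurable_funTS; apply: measurable_funM.
    apply: (measurableT_comp (measurable_powR _)).
    exact: measurable_funB.
  exact: measurable_powR.
- by move=> x _; rewrite lee_fin mulr_ge0 ?powR_ge0.
rewrite integral_Beta// -!EFinM lee_fin le_eqVlt; apply/orP; left; apply/eqP.
have -> : a * n.+2%:R = a + b by rewrite /b -(natr1 n.+1); ring.
have Gb : Gamma b != 0 by rewrite gt_eqF// Gamma_gt0.
have Gab : Gamma (a + b) != 0 by rewrite gt_eqF// Gamma_gt0// addr_gt0.
rewrite gE// -/M AE KE -/b.
transitivity (C ^+ n.+1 * (Gamma a ^+ n.+2 / Gamma (a + b)) *
  ((r `^ (- p) * M `^ (- q) * r `^ D)^-1 *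
   (r `^ (- D) * M `^ (- D - q - q - (q + D) * n%:R) * r `^ (a + b - 1)))).
  congr (_ * _).
  rewrite !powR_expR_ln//.
  set lr := ln r; set lM := ln M.
  rewrite exprMn -!expRM_natl -!expRD -expRN -!expRD; congr expR.
  by rewrite /b /a /D -!natr1; field.
rewrite !exprS; set u := (_ * _ * _)^-1; field.
by rewrite Gb Gab.
Qed.

(** For r >= 1 the factor r^(d-p) max(1, r)^(-(q + (d-1)/2)) is a single power
    of r. *)
Lemma G_ge_powR (R : realType) (d : nat) (m p q r0 r : R) (g : R -> R)
    (n : nat) :
  (1 <= d)%N -> 0 <= m -> p < d%:R -> 0 <= q ->
  (forall s, 0 < s -> g s = s `^ (- p) * Num.max 1 s `^ (- q)) ->
  1 <= r0 -> 1 <= r -> (1 <= n)%N ->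
  (((C_const d m r0 / 2) ^+ (n - 1) *
    (Gamma (d%:R - p) ^+ n / Gamma ((d%:R - p) * n%:R)) *
    r `^ (((d%:R + 1) / 2 - (p + q)) * (n%:R - 1)))%:E <= G d m g n r)%E.
Proof.
move=> d1 m0 pd q0 gE r01 r1; case: n => // n _.
have rp : 0 < r by exact: lt_le_trans r1.
apply: le_trans (G_ge d1 m0 pd q0 gE n rp).
have C0 := C_const_ge0 m r0 d1.
have CC := C_const_anti d1 m0 r01.
rewrite lee_fin subn1/= (max_idPr r1).
have -> : n.+1%:R - 1 = n%:R :> R by rewrite -natr1 addrK.
have -> : r `^ (((d%:R + 1) / 2 - (p + q)) * n%:R) =
    (r `^ (d%:R - p) * r `^ (- (q + (d%:R - 1) / 2))) ^+ n.
  rewrite -powRD; last by rewrite (gt_eqF rp) implybT.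
  rewrite powRrM powR_mulrn ?powR_ge0//.
  by have -> : (d%:R + 1) / 2 - (p + q) = d%:R - p - (q + (d%:R - 1) / 2)
    by field.
have a0 : 0 < d%:R - p by rewrite subr_gt0.
rewrite ler_wpM2r ?exprn_ge0 ?mulr_ge0 ?powR_ge0//.
rewrite ler_wpM2r//.
  by rewrite divr_ge0 ?exprn_ge0// ltW// Gamma_gt0// mulr_gt0.
by apply: lerXn2r; rewrite ?nnegrE; lra.
Qed.

Theorem lemma4p9 (R : realType) (d : nat) (m r gamma : R) (n : nat) :
  (1 <= d)%N -> 0 < m -> 1 <= r -> (1 <= n)%N ->
  0 <= gamma -> gamma < (d%:R + 1) / 2 ->
  (forall g : R -> R,
     (forall s : R, 0 < s -> g s = s `^ (- gamma)) ->
     (((C_const d m (R_const (d%:R - gamma) (d%:R - gamma)) / 2) ^+ (n - 1) *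
       (Gamma (d%:R - gamma) ^+ n / Gamma ((d%:R - gamma) * n%:R)) *
       r `^ (((d%:R + 1) / 2 - gamma) * (n%:R - 1)))%:E <= G d m g n r)%E)
  /\
  (forall g : R -> R,
     (forall s : R, 0 < s -> g s = (Num.max 1 s) `^ (- gamma)) ->
     (((C_const d m (R_const 1 d%:R) / 2) ^+ (n - 1) *
       (Gamma d%:R ^+ n / Gamma (d%:R * n%:R)) *
       r `^ (((d%:R + 1) / 2 - gamma) * (n%:R - 1)))%:E <= G d m g n r)%E).
Proof.
move=> d1 m0 r1 n1 gamma0 gammad.
have dR : 1 <= d%:R :> R by rewrite ler1n.
split=> g gE.
- have a0 : 0 < d%:R - gamma by lra.
  have gE' s : 0 < s -> g s = s `^ (- gamma) * Num.max 1 s `^ (- 0).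
    by move=> s0; rewrite gE// oppr0 powRr0 mulr1.
  have R1 : 1 <= R_const (d%:R - gamma) (d%:R - gamma).
    by apply: R_const_ge1 => //; right.
  have gd : gamma < d%:R by lra.
  have := G_ge_powR d1 (ltW m0) gd (lexx 0) gE' R1 r1 n1.
  by rewrite addr0.
- have gE' s : 0 < s -> g s = s `^ (- 0) * Num.max 1 s `^ (- gamma).
    by move=> s0; rewrite gE// oppr0 powRr0 mul1r.
  have R1 : 1 <= R_const 1 d%:R :> R.
    by apply: R_const_ge1; [exact: ltr01|exact: lt_le_trans dR|left].
  have d0 : 0 < d%:R :> R by exact: lt_le_trans dR.
  have := G_ge_powR d1 (ltW m0) d0 gamma0 gE' R1 r1 n1.
  by rewrite add0r subr0.
Qed.
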